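(* Let $m$ be an integer with $1\le m\le d-2$, and let $X\subseteq\mathbb{S}^{d-1}$ be a spherical $s$-distance set with inner product set $A$ and cardinality $N=|X|$. Then $$\sum_{G}\sum_{\mathbf{u}, \mathbf{v} \in A^m}\sum_{t \in A} N_m(G; \mathbf{u}, \mathbf{v}, t) = \frac{N!}{(N-m-2)!},$$ in which $G$ is summed over all possible $m\times m$ proper Gram matrices. Let $A' = A \cup \{1\}$ and let $\{e_{\mathbf{u}}: \mathbf{u} \in (A')^m\}$ be the standard basis of $\mathbb{R}^{(s+1)^m}$. Then for every fixed $m \times m$ proper Gram matrix $G$ and every integer $k\ge 0$, the matrix $$\mathcal{Q}^{d, m}_k(G; X) = \sum_{\mathbf{u}, \mathbf{v} \in (A')^m}\sum_{t \in A'} N_m(G; \mathbf{u}, \mathbf{v}, t)\,Q^{d, m}_k(G; \mathbf{u}, \mathbf{v}, t)\,e_{\mathbf{u}}e_{\mathbf{v}}^{\top}$$ is positive semidefinite.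
   Context: $\mathbb{S}^{d-1}$ is the unit sphere in $\mathbb{R}^d$. For a finite set $X\subseteq\mathbb{S}^{d-1}$ the inner product set is $A=A(X)=\{c\cdot c': c,c'\in X, c\ne c'\}$; $X$ is a spherical $s$-distance set if $|A(X)|=s$. The quotient $N!/(N-m-2)!$ denotes $N(N-1)\cdots(N-m-1)$. A proper $m\times m$ Gram matrix is a positive definite symmetric matrix with diagonal entries $1$ and off-diagonal entries in $A$ (i.e. a possible Gram matrix of $m$ linearly independent vectors of $X$). For $\mathbf{u},\mathbf{v}\in\mathbb{R}^m$ (column vectors) and $t\in\mathbb{R}$, $(G;\mathbf{u},\mathbf{v},t)$ denotes the $(m+2)\times(m+2)$ matrix $$\begin{pmatrix} G & \mathbf{u} & \mathbf{v}\\ \mathbf{u}^\top & 1 & t\\ \mathbf{v}^\top & t & 1\end{pmatrix},$$ and, for a proper Gram matrix $G$, $N_m(G;\mathbf{u},\mathbf{v},t)$ is the number of $(m+2)$-tuples $(b_1,\dots,b_m,c,c')\in X^{m+2}$ whose Gram matrix (matrix of pairwise inner products, in this order) equals $(G;\mathbf{u},\mathbf{v},t)$. Gegenbauer polynomials $P^n_k$ ($n\ge2$): $P^n_0(t)=1$, $P^n_1(t)=t$, and $P^n_k(t)=\frac{1}{k+n-3}\big((2k+n-4)\,t\,P^n_{k-1}(t)-(k-1)P^n_{k-2}(t)\big)$ for $k\ge2$. For a proper Gram matrix $G$ define $$Q^{d,m}_k(G;\mathbf{u},\mathbf{v},t)=(1-\mathbf{u}^\top G^{-1}\mathbf{u})^{k/2}(1-\mathbf{v}^\top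 G^{-1}\mathbf{v})^{k/2}P^{d-m}_k\left(\frac{t-\mathbf{u}^\top G^{-1}\mathbf{v}}{\sqrt{(1-\mathbf{u}^\top G^{-1}\mathbf{u})(1-\mathbf{v}^\top G^{-1}\mathbf{v})}}\right),$$ which is a polynomial in the entries of $\mathbf{u},\mathbf{v}$ and $t$ (because $P^{d-m}_k$ has the parity of $k$) and is evaluated as such.
   Formalization: The counting identity is proved when, in every (m+2)-tuple of distinct points of X, the first m are linearly independent; without this it fails, e.g. d=4, m=2, X={e1,-e1,e2,e3} gives 20, not 24. The condition is exactly necessary and sufficient. *)

(* Defs.v *)
From HB Require Import structures.
From mathcomp Require Import all_boot all_order all_algebra.
From mathcomp Require Import finmap boolp reals.

Set Implicit Arguments.
Unset Strict Implicit.
Unset Printing Implicit Defensive.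

Import Order.TTheory GRing.Theory Num.Theory.

Local Open Scope fset_scope.
Local Open Scope ring_scope.

(* The library norm on matrices is the maximum norm, so the Euclidean geometry
   is expressed through this inner product. *)
Definition dotv {R : realType} {d : nat} (x y : 'cV[R]_d) : R :=
  (x^T *m y) 0 0.

Definition on_sphere {R : realType} {d : nat} (X : {fset 'cV[R]_d}) : Prop :=
  forall x, x \in X -> dotv x x = 1.

Definition inner_products {R : realType} {d : nat} (X : {fset 'cV[R]_d}) :
    {fset R} :=
  [fset dotv c c' | c in X, c' in X & c != c'].

Definition inner_products1 {R : realType} {d : nat} (X : {fset 'cV[R]_d}) :
    {fset R} :=
  inner_products X `|` [fset 1].

Definition spherical_distance_set {R : realType} {d : nat} (s : nat)
    (X : {fset 'cV[R]_d}) : Prop :=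
  on_sphere X /\ #|` inner_products X | = s.

Definition posdef {R : realType} {n : nat} (M : 'M[R]_n) : Prop :=
  M^T = M /\ forall x : 'cV[R]_n, x != 0 -> 0 < (x^T *m M *m x) 0 0.

Definition possemidef {R : realType} {n : nat} (M : 'M[R]_n) : Prop :=
  M^T = M /\ forall x : 'cV[R]_n, 0 <= (x^T *m M *m x) 0 0.

Definition proper_gram {R : realType} {m : nat} (A : {fset R}) (G : 'M[R]_m) :
    Prop :=
  [/\ posdef G, forall i, G i i = 1 & forall i j, i != j -> G i j \in A].

Definition gram {R : realType} {d n : nat} (w : 'I_n -> 'cV[R]_d) : 'M[R]_n :=
  \matrix_(i, j) dotv (w i) (w j).

Definition bordered {R : realType} {m : nat} (G : 'M[R]_m) (u v : 'cV[R]_m)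
    (t : R) : 'M[R]_(m + (1 + 1)) :=
  block_mx G (row_mx u v) (col_mx u^T v^T) (block_mx 1%:M t%:M t%:M 1%:M).

Definition Ncount {R : realType} {d m : nat} (X : {fset 'cV[R]_d})
    (G : 'M[R]_m) (u v : 'cV[R]_m) (t : R) : nat :=
  #|[set w : {ffun 'I_(m + 2) -> X} |
      gram (fun i => val (w i)) == bordered G u v t]|.

(* The truncated subtractions are exact for n >= 2, as k = k2 + 2 there. *)
Fixpoint gegenbauer {R : realType} (n k : nat) {struct k} : {poly R} :=
  match k with
  | 0 => 1
  | k1.+1 =>
    match k1 with
    | 0 => 'X
    | k2.+1 =>
      (k + n - 3)%:R^-1 *:
        ((2 * k + n - 4)%:R *: ('X * gegenbauer n k1)
         - (k - 1)%:R *: gegenbauer n k2)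
    end
  end.

Definition gramres {R : realType} {m : nat} (G : 'M[R]_m) (u v : 'cV[R]_m)
    (t : R) : R :=
  t - (u^T *m invmx G *m v) 0 0.

(* The defining expression
     (a b)^(k/2) P_k(c / sqrt (a b)),
   with a, b, c the values of gramres at (u, u, 1), (v, v, 1) and (u, v, t), is
   expanded into the polynomial sum_j p_j c^j (a b)^((k - j)/2), where p_j = 0
   unless j <= k and k - j is even.  It thus makes sense for all real a, b;
   see Qgegenbauer_closed_form for the agreement when a, b > 0. *)
Definition Qgegenbauer {R : realType} (d m k : nat) (G : 'M[R]_m)
    (u v : 'cV[R]_m) (t : R) : R :=
  \sum_(j < k.+1) (gegenbauer (d - m) k)`_j * gramres G u v t ^+ j
    * (gramres G u u 1 * gramres G v v 1) ^+ (k - j)./2.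

Definition basis_vec {R : realType} {I : finType} (i : I) : 'cV[R]_#|I| :=
  delta_mx (enum_rank i) 0.

(* The index set (A')^m is the finite type of columns with entries in A';
   its cardinality is (s + 1)^m, see card_index. *)
Definition Qmatrix {R : realType} {d m : nat} (k : nat) (G : 'M[R]_m)
    (X : {fset 'cV[R]_d}) : 'M[R]_#|{: 'cV[inner_products1 X]_m}| :=
  \sum_(u : 'cV[inner_products1 X]_m) \sum_(v : 'cV[inner_products1 X]_m)
    \sum_(t : inner_products1 X)
      ((Ncount X G (map_mx val u) (map_mx val v) (val t))%:R
       * Qgegenbauer d k G (map_mx val u) (map_mx val v) (val t))
      *: (basis_vec u *m (basis_vec v)^T).

(* In every (m+2)-tuple of distinct points of X the first m are linearly
   independent.  Positive definite G only count such tuples, so the identity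
   with N!/(N-m-2)! holds exactly for these X: for m = 2 and
   X = {e1, -e1, e2, e3} in R^4 the sum is 20, whereas 4!/0! = 24.
   The condition is vacuous for |X| < m + 2 and automatic for m = 1. *)
Definition independent_heads {R : realType} {d : nat} (m : nat)
    (X : {fset 'cV[R]_d}) : Prop :=
  forall w : {ffun 'I_(m + 2) -> X}, injective w ->
    free [seq val (w (lshift 2 i)) | i : 'I_m].

Lemma card_index {R : realType} {d : nat} (s m : nat) (X : {fset 'cV[R]_d}) :
  spherical_distance_set s X ->
  #|{: 'cV[inner_products1 X]_m}| = (s.+1 ^ m)%N.
Proof.
case=> sX sA; rewrite card_mx muln1 -cardfE; congr (_ ^ _)%N.
rewrite /inner_products1 fsetUC cardfsU1 sA.
suff -> : 1 \notin inner_products X by [].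
apply/negP => /imfset2P[/= x xX [y]]; rewrite inE => /andP[yX xy] e.
have dotE (a b : 'cV[R]_d) : dotv a b = \sum_i a i 0 * b i 0.
  by rewrite /dotv mxE; apply: eq_bigr => i _; rewrite mxE.
suff /eqP : x = y by rewrite (negbTE xy).
have : \sum_i (x i 0 - y i 0) ^+ 2 = 0.
  transitivity (dotv x x - dotv x y *+ 2 + dotv y y).
    rewrite !dotE -sumrMnl -sumrN -!big_split /=.
    by apply: eq_bigr => i _; rewrite sqrrB !expr2.
  by rewrite sX // sX // -e mulr2n opprD addrA subrr add0r addNr.
move=> /eqP; rewrite psumr_eq0 => [/allP h|i _]; last exact: sqr_ge0.
apply/colP => i; apply/eqP; rewrite -subr_eq0 -sqrf_eq0.
by have := h i (mem_index_enum _).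
Qed.

Lemma gegenbauer_coef_eq0 {R : realType} (n k j : nat) :
  (k < j)%N || odd (k + j) -> (gegenbauer n k : {poly R})`_j = 0.
Proof.
suff: (forall j, (k < j)%N || odd (k + j) ->
         (gegenbauer n k : {poly R})`_j = 0) /\
      (forall j, (k.+1 < j)%N || odd (k.+1 + j) ->
         (gegenbauer n k.+1 : {poly R})`_j = 0) by case=> + _; exact.
elim: k {j} => [|k [IH0 IH1]].
  split=> [] [|[|j]] //= _; by rewrite ?coef1 ?coefX.
split=> // j jk; rewrite [gegenbauer _ _]/= coefZ coefB !coefZ coefXM.
have -> : (gegenbauer n k : {poly R})`_j = 0.
  apply: IH0; case/orP: jk => [jk|].
    by rewrite (leq_trans _ jk) // !ltnS -addn2 leq_addr.
  by rewrite /= negbK => ->; rewrite orbT.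
rewrite mulr0 subr0; case: j jk => [|j] jk /=; first by rewrite !mulr0.
by rewrite -[X in _ * (_ * X)]/((gegenbauer n k.+1)`_j) IH1 ?mulr0 //;
  move: jk; rewrite ltnS !addSn addnS /= negbK.
Qed.

Lemma Qgegenbauer_closed_form {R : realType} (d m k : nat) (G : 'M[R]_m)
    (u v : 'cV[R]_m) (t : R) :
  0 < gramres G u u 1 -> 0 < gramres G v v 1 ->
  Qgegenbauer d k G u v t =
    Num.sqrt (gramres G u u 1) ^+ k * Num.sqrt (gramres G v v 1) ^+ k
    * (gegenbauer (d - m) k).[gramres G u v t
        / Num.sqrt (gramres G u u 1 * gramres G v v 1)].
Proof.
rewrite /Qgegenbauer; set a := gramres G u u 1; set b := gramres G v v 1.
set c := gramres G u v t; move=> a0 b0; set r := Num.sqrt (a * b).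
have r0 : r != 0 by rewrite sqrtr_eq0 -ltNge mulr_gt0.
have r2 : r ^+ 2 = a * b by rewrite sqr_sqrtr // ltW // mulr_gt0.
rewrite -exprMn -sqrtrM ?(ltW a0) // -/r.
rewrite (@horner_coef_wide _ k.+1); last first.
  by apply/leq_sizeP => j kj; apply: gegenbauer_coef_eq0; rewrite kj.
rewrite mulr_sumr; apply: eq_bigr => j _.
have jk : (j <= k)%N by rewrite -ltnS.
case: (boolP (odd (k + j))) => okj.
  by rewrite gegenbauer_coef_eq0 ?okj ?orbT // !mul0r mulr0.
have e : (k - j = (k - j)./2.*2)%N.
  by rewrite even_halfK // oddB // -oddD.
rewrite -r2 -exprM mul2n -e expr_div_n -[X in r ^+ X * _](subnK jk) exprD.
by rewrite [_ * (c ^+ j / _)]mulrA mulrCA mulfK // expf_neq0.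
Qed.

(* Main.v *)
Require Import Defs.
From mathcomp Require Import all_boot all_order all_algebra.
From mathcomp Require Import ring zify mpoly.
From mathcomp Require Import finmap boolp reals.

Set Implicit Arguments.
Unset Strict Implicit.
Unset Printing Implicit Defensive.

Import Order.TTheory GRing.Theory Num.Theory.

Local Open Scope fset_scope.
Local Open Scope ring_scope.

(** The counting identity is double counting.  A tuple w of m + 2 points of X
    determines the data (G, u, v, t) for which its Gram matrix is the bordered
    one, so the sum counts the tuples whose data is admissible: G proper, and
    the entries of u, v and t in A.  As 1 is not in A, such a tuple is injective
    ([gram_bordered_injective]); conversely the entries of an injective tuple
    are admissible, G being positive definite because the first m points are
    independent ([card_bordered_injective]).

    For the second part, the matrix splits as a sum over the m-tuples b with
    Gram matrix G ([Qmatrix_sum]), and each summand is built from the kernel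
    (c, c') |-> Q_k(G; u, v, t) with u = (b_i . c), v = (b_i . c'), t = c . c'.
    Let P be the orthogonal projection onto the complement of the span of b.
    Then t - u^T G^-1 v = c^T P c' ([orth_proj_gramres]), so that this kernel is
    Z_k(Pc, Pc'), where, with n = d - m,
        Z_k(x, y) = |x|^k |y|^k P^n_k(x . y / (|x| |y|)).
    It remains to see that Z_k is a positive definite kernel on an
    n-dimensional space (Schoenberg).

    This is proved by writing a positive multiple of Z_k as a finite sum
    of products h(x) h(y) of polynomials, by induction on k.  The harmonic
    polynomials of degree k + 1 are generated, for k > 0, by those of degree k
    through the raising operators
        L_i = (2k + n - 2) x_i - |x|^2 d/dx_i,
    and applying L_i in x and in y sends h(x) h(y) to (L_i h)(x) (L_i h)(y).
    The point is that summing over i maps Z_k to a multiple of Z_{k+1}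
    ([zonal_raise]).  That identity needs only the three-term recurrence for
    Z_k and three consequences of it, each an induction on k:
    y . grad_x Z_k = k |y|^2 Z_{k-1} and its mirror image ([zonal_lower]),
    Euler's identity ([zonal_euler]), and
    sum_i (d/dx_i) (d/dy_i) Z_k = k (2k + n - 2) Z_{k-1} ([zonal_laplace]).

    No orthonormal basis of the complement is chosen: coordinates and partial
    derivatives on R^d are multiplied by P, and the dimension n enters only as
    the trace of P. *)

(** * Derivations of a commutative ring *)

Section Derivations.

Variable B : comNzRingType.

Definition derivation (D : B -> B) : Prop :=
  (forall f g, D (f - g) = D f - D g) /\
  (forall f g, D (f * g) = D f * g + f * D g).

Variables (D : B -> B) (derD : derivation D).

Let DB f g : D (f - g) = D f - D g. Proof. by case: derD. Qed.
Let DM f g : D (f * g) = D f * g + f * D g. Proof. by case: derD. Qed.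

Lemma derivation0 : D 0 = 0.
Proof. by have := DB 0 0; rewrite !subrr. Qed.

Lemma derivationN f : D (- f) = - D f.
Proof. by rewrite -sub0r DB derivation0 sub0r. Qed.

Lemma derivationD f g : D (f + g) = D f + D g.
Proof. by rewrite -[g in LHS]opprK DB derivationN opprK. Qed.

Lemma derivation_sum (I : Type) (r : seq I) (P : pred I) (F : I -> B) :
  D (\sum_(i <- r | P i) F i) = \sum_(i <- r | P i) D (F i).
Proof. exact: (big_morph D derivationD derivation0). Qed.

Lemma derivation1 : D 1 = 0.
Proof.
have := DM 1 1; rewrite !mulr1 mul1r => e.
by apply/eqP; rewrite -(inj_eq (addrI (D 1))) addr0 -e.
Qed.

Lemma derivation_natM n f : D (n%:R * f) = n%:R * D f.
Proof.
elim: n => [|n IHn]; first by rewrite !mul0r derivation0.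
by rewrite -addn1 natrD !mulrDl derivationD IHn !mul1r.
Qed.

End Derivations.

Lemma derivation_lincomb (B : comNzRingType) (I : finType) (c : I -> B)
    (D : I -> B -> B) :
  (forall i, derivation (D i)) -> derivation (fun f => \sum_i c i * D i f).
Proof.
move=> derD; split=> f g.
  rewrite -sumrB; apply: eq_bigr => i _.
  by case: (derD i) => -> _; rewrite mulrBr.
rewrite mulr_suml mulr_sumr -big_split; apply: eq_bigr => i _.
by case: (derD i) => _ ->; rewrite mulrDr mulrA mulrCA.
Qed.

(** * The Gegenbauer recurrence and its differential consequences *)

(** The recurrence of the polynomials |x|^k |y|^k P^n_k(x . y / (|x| |y|)),
    where s stands for x . y and q for |x|^2 |y|^2.  The parameter is p = n - 2,
    and denominators are cleared: all coefficients are then natural numbers, on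
    which derivations vanish, in any commutative ring. *)
Definition zonal_sequence (B : comNzRingType) (p : nat) (s q : B)
    (Z : nat -> B) : Prop :=
  [/\ Z 0 = 1, Z 1 = s & forall k,
    (k + p + 1)%:R * Z k.+2
      = (2 * k + p + 2)%:R * (s * Z k.+1) - (k + 1)%:R * (q * Z k)].

Section ZonalSequence.

Variables (B : comNzRingType) (p : nat) (s q : B) (Z : nat -> B).
Hypothesis natI : forall n (f g : B), n.+1%:R * f = n.+1%:R * g -> f = g.
Hypothesis Zzonal : zonal_sequence p s q Z.

Let Z0 : Z 0 = 1. Proof. by case: Zzonal. Qed.
Let Z1 : Z 1 = s. Proof. by case: Zzonal. Qed.
Let ZS k : (k + p + 1)%:R * Z k.+2
      = (2 * k + p + 2)%:R * (s * Z k.+1) - (k + 1)%:R * (q * Z k).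
Proof. by case: Zzonal. Qed.
Let cI k f g : (k + p + 1)%:R * f = (k + p + 1)%:R * g :> B -> f = g.
Proof. by rewrite addn1; apply: natI. Qed.

(** Z_k is homogeneous of degree k when s has degree 1 and q degree 2, as is
    the case in x alone and in y alone. *)
Lemma zonal_euler (D : B -> B) :
  derivation D -> D s = s -> D q = 2 * q -> forall k, D (Z k) = k%:R * Z k.
Proof.
move=> derD Ds Dq k; case: (derD) => DB DM.
suff: D (Z k) = k%:R * Z k /\ D (Z k.+1) = k.+1%:R * Z k.+1 by case.
elim: k => [|k [IH0 IH1]].
  by rewrite Z0 Z1 (derivation1 derD) mul0r mul1r.
split=> //; apply: (@cI k).
rewrite -(derivation_natM derD) ZS [RHS]mulrCA ZS.
rewrite DB !(derivation_natM derD) !DM IH0 IH1 Ds Dq.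
by ring.
Qed.

(** The recurrence shifted by one: it then also covers k = 0, where the
    meaningless term Z k.-1 is killed by its factor k. *)
Lemma zonal_rec k :
  k%:R * (q * Z k.-1) = (2 * k + p)%:R * (s * Z k) - (k + p)%:R * Z k.+1.
Proof.
case: k => [|k] /=; first by rewrite Z0 Z1 mulr1; ring.
have := ZS k; rewrite (_ : k + p + 1 = k.+1 + p)%N; last by rewrite addnAC addn1.
by move=> ->; ring.
Qed.

(** For D = y . grad_x and w = |y|^2 this is the homogeneous form of the
    classical (1 - t^2) P_k' + k t P_k = k P_{k-1}. *)
Lemma zonal_lower (D : B -> B) (w : B) :
  derivation D -> D s = w -> D q = 2 * (w * s) ->
  forall k, D (Z k) = k%:R * (w * Z k.-1).
Proof.
move=> derD Ds Dq k; case: (derD) => DB DM.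
suff: D (Z k) = k%:R * (w * Z k.-1) /\ D (Z k.+1) = k.+1%:R * (w * Z k) by case.
elim: k => [|k [IH0 IH1]].
  by rewrite Z0 Z1 (derivation1 derD) Ds; split; ring.
split=> //; apply: (@cI k).
rewrite -(derivation_natM derD) ZS DB !(derivation_natM derD) !DM.
rewrite IH0 IH1 Ds Dq.
transitivity ((2 * k + p + 2)%:R * (w * Z k.+1)
  + (k + 1)%:R * w * ((2 * k + p)%:R * (s * Z k) - k%:R * (q * Z k.-1))).
  by ring.
by rewrite zonal_rec; ring.
Qed.

End ZonalSequence.

(** * Raising operators *)

Section BilinearOperators.

(* The elements x i, y i are the coordinates of Px and Py for an orthogonal
   projection P, and Dx i, Dy i the components of the projected gradients. *)
Variables (B : comNzRingType) (I : finType) (P : I -> I -> B) (x y : I -> B).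
Variables (Dx Dy : I -> B -> B).
Hypotheses (derDx : forall i, derivation (Dx i)).
Hypotheses (derDy : forall i, derivation (Dy i)).
Hypotheses (Dxx : forall i j, Dx i (x j) = P i j).
Hypotheses (Dxy : forall i j, Dx i (y j) = 0).
Hypotheses (Dyx : forall i j, Dy i (x j) = 0).
Hypotheses (Dyy : forall i j, Dy i (y j) = P i j).
Hypotheses (Px : forall i, \sum_j P i j * x j = x i).
Hypotheses (Py : forall i, \sum_j P i j * y j = y i).

Let s := \sum_i x i * y i.
Let X := \sum_i x i * x i.
Let Y := \sum_i y i * y i.

Let DxB i f g : Dx i (f - g) = Dx i f - Dx i g.
Proof. by case: (derDx i). Qed.
Let DxM i f g : Dx i (f * g) = Dx i f * g + f * Dx i g.
Proof. by case: (derDx i). Qed.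
Let DyB i f g : Dy i (f - g) = Dy i f - Dy i g.
Proof. by case: (derDy i). Qed.
Let DyM i f g : Dy i (f * g) = Dy i f * g + f * Dy i g.
Proof. by case: (derDy i). Qed.
Let DxD i f g : Dx i (f + g) = Dx i f + Dx i g.
Proof. exact: derivationD. Qed.
Let DyD i f g : Dy i (f + g) = Dy i f + Dy i g.
Proof. exact: derivationD. Qed.

Let Dxs i : Dx i s = y i.
Proof.
rewrite /s (derivation_sum (derDx i)) -[RHS]Py; apply: eq_bigr => j _.
by rewrite DxM Dxx Dxy mulr0 addr0.
Qed.

Let Dys i : Dy i s = x i.
Proof.
rewrite /s (derivation_sum (derDy i)) -[RHS]Px; apply: eq_bigr => j _.
by rewrite DyM Dyx Dyy mul0r add0r mulrC.
Qed.

Let DxX i : Dx i X = 2 * x i.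
Proof.
rewrite /X (derivation_sum (derDx i)) -[in RHS]Px mulr_sumr.
by apply: eq_bigr => j _; rewrite DxM Dxx; ring.
Qed.

Let DyY i : Dy i Y = 2 * y i.
Proof.
rewrite /Y (derivation_sum (derDy i)) -[in RHS]Py mulr_sumr.
by apply: eq_bigr => j _; rewrite DyM Dyy; ring.
Qed.

Let DxY i : Dx i Y = 0.
Proof.
rewrite /Y (derivation_sum (derDx i)) big1 // => j _.
by rewrite DxM Dxy mul0r mulr0 addr0.
Qed.

Let DyX i : Dy i X = 0.
Proof.
rewrite /X (derivation_sum (derDy i)) big1 // => j _.
by rewrite DyM Dyx mul0r mulr0 addr0.
Qed.

Variables (p : nat) (Z : nat -> B).
Hypothesis trP : \sum_i P i i = (p + 2)%:R.
Hypothesis natI : forall n (f g : B), n.+1%:R * f = n.+1%:R * g -> f = g.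
Hypothesis Zzonal : zonal_sequence p s (X * Y) Z.

Let xDx k : \sum_i x i * Dx i (Z k) = k%:R * Z k.
Proof.
apply: (zonal_euler natI Zzonal (derivation_lincomb x derDx)).
  by apply: eq_bigr => i _; rewrite Dxs.
rewrite [in RHS]/X [in RHS]mulr_suml [RHS]mulr_sumr; apply: eq_bigr => i _.
by rewrite DxM DxX DxY -/Y; ring.
Qed.

Let yDy k : \sum_i y i * Dy i (Z k) = k%:R * Z k.
Proof.
apply: (zonal_euler natI Zzonal (derivation_lincomb y derDy)).
  by apply: eq_bigr => i _; rewrite Dys mulrC.
rewrite [in RHS]/Y ![in RHS]mulr_sumr; apply: eq_bigr => i _.
by rewrite DyM DyX DyY; ring.
Qed.

Let yDx k : \sum_i y i * Dx i (Z k) = k%:R * (Y * Z k.-1).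
Proof.
apply: (zonal_lower natI Zzonal (derivation_lincomb y derDx)).
  by apply: eq_bigr => i _; rewrite Dxs.
rewrite [in RHS]/s ![in RHS]mulr_sumr; apply: eq_bigr => i _.
by rewrite DxM DxX DxY; ring.
Qed.

Let xDy k : \sum_i x i * Dy i (Z k) = k%:R * (X * Z k.-1).
Proof.
apply: (zonal_lower natI Zzonal (derivation_lincomb x derDy)).
  by apply: eq_bigr => i _; rewrite Dys.
rewrite [in RHS]/s ![in RHS]mulr_sumr; apply: eq_bigr => i _.
by rewrite DyM DyX DyY; ring.
Qed.

Let L f := \sum_i Dx i (Dy i f).

Let LB f g : L (f - g) = L f - L g.
Proof. by rewrite /L -sumrB; apply: eq_bigr => i _; rewrite DyB DxB. Qed.

Let Lnat n f : L (n%:R * f) = n%:R * L f.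
Proof.
rewrite /L mulr_sumr; apply: eq_bigr => i _.
by rewrite (derivation_natM (derDy i)) (derivation_natM (derDx i)).
Qed.

Let Ls f : L (s * f) = (p + 2)%:R * f + s * L f
    + \sum_i y i * Dy i f + \sum_i x i * Dx i f.
Proof.
rewrite -trP [in RHS]mulr_suml [s * L f]mulr_sumr -!big_split [in LHS]/L.
apply: eq_bigr => i _ /=.
by rewrite DyM DxD !DxM Dys Dxs Dxx; ring.
Qed.

Let Lq f : L (X * Y * f) = 4 * s * f + X * Y * L f
    + 2 * Y * (\sum_i x i * Dy i f) + 2 * X * (\sum_i y i * Dx i f).
Proof.
rewrite [4 * s]mulr_sumr [in RHS]mulr_suml ![in RHS]mulr_sumr -!big_split /=.
apply: eq_bigr => i _.
have D2y : Dx i (2 * y i) = 0 by rewrite (derivation_natM (derDx i)) Dxy mulr0.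
rewrite !DyM DyX DyY mul0r add0r DxD DxM (DxM _ X) (DxM _ _ (Dy i f)).
rewrite (DxM _ X Y).
(* Distributing over sums above also opened the sums s, X and Y. *)
by rewrite DxX DxY D2y -!mulr_sumr -/X -/Y; ring.
Qed.

(** The mixed Laplacian is a second-order operator, so on s Z_{k+1} and q Z_k it
    produces cross terms besides the Leibniz ones.  These are exactly the
    first-order expressions computed by [zonal_euler] and [zonal_lower], which
    is why the induction closes. *)
Lemma zonal_laplace k :
  \sum_i Dx i (Dy i (Z k)) = (p + 2 * k)%:R * (k%:R * Z k.-1).
Proof.
rewrite -/(L (Z k)).
case: (Zzonal) => Z0 Z1 ZS.
suff: L (Z k) = (p + 2 * k)%:R * (k%:R * Z k.-1) /\
      L (Z k.+1) = (p + 2 * k.+1)%:R * (k.+1%:R * Z k) by case.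
elim: k => [|k [IH0 IH1]].
  split; last first.
    rewrite Z1 Z0 /L; under eq_bigr => i _ do rewrite Dys Dxx.
    by rewrite trP; ring.
  rewrite Z0 !mul0r mulr0 /L big1 // => i _.
  by rewrite (derivation1 (derDy i)) (derivation0 (derDx i)).
split=> //; apply: (natI (n := k + p)); rewrite -(addn1 (k + p)).
rewrite -Lnat ZS LB !Lnat Ls Lq IH0 IH1 xDx yDy xDy yDx.
(* The term in Z k.-1 is isolated in the form on which zonal_rec acts. *)
transitivity ((2 * k + p + 2)%:R
    * ((p + 2 * k + 4)%:R * Z k.+1
       + s * ((p + 2 * k.+1)%:R * (k.+1%:R * Z k)))
  - (k + 1)%:R
    * (4 * s * Z k + (p + 2 * k + 4)%:R * (k%:R * (X * Y * Z k.-1)))).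
  by rewrite /=; ring.
by rewrite (zonal_rec Zzonal) /=; ring.
Qed.

(** Expanding the product of the two operators gives N^2 s Z_k, twice
    - N k q Z_{k-1} from the mixed first-order terms, and N k q Z_{k-1} from the
    mixed Laplacian; what is left, N (N s Z_k - k q Z_{k-1}), is
    N (k + p) Z_{k+1} by [zonal_rec]. *)
Lemma zonal_raise k :
  let N := (2 * k + p)%:R in
  let Lx i f := N * (x i * f) - X * Dx i f in
  let Ly i f := N * (y i * f) - Y * Dy i f in
  \sum_i Lx i (Ly i (Z k)) = ((2 * k + p) * (k + p))%:R * Z k.+1.
Proof.
move=> N Lx Ly; rewrite /Lx /Ly {Lx Ly}.
transitivity (N * N * (s * Z k) - N * Y * (\sum_i x i * Dy i (Z k))
   - N * X * (\sum_i y i * Dx i (Z k)) + X * Y * (\sum_i Dx i (Dy i (Z k)))).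
  rewrite [in RHS]mulr_suml ![in RHS]mulr_sumr -!sumrB -big_split /=.
  apply: eq_bigr => i _.
  rewrite DxB (derivation_natM (derDx i)) !DxM Dxy DxY.
  by rewrite -!mulr_sumr -/X -/Y /N; ring.
rewrite xDy yDx zonal_laplace.
transitivity (N * (N * (s * Z k) - k%:R * (X * Y * Z k.-1))).
  by rewrite /N; ring.
by rewrite (zonal_rec Zzonal) /N; ring.
Qed.

End BilinearOperators.

(** * Realization by Gegenbauer polynomials *)

(** The expression defining [Qgegenbauer], in an arbitrary commutative algebra:
    it is needed both for real numbers and for polynomials in the coordinates
    of two points. *)
Definition zonal (R : realType) (B : comAlgType R) (p : nat) (s q : B)
    (k : nat) : B :=
  \sum_(j < k.+1) (gegenbauer p.+2 k)`_j *: (s ^+ j * q ^+ (k - j)./2).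

Lemma alg_natI (R : realType) (B : comAlgType R) (n : nat) (f g : B) :
  n.+1%:R * f = n.+1%:R * g -> f = g.
Proof.
rewrite !mulr_natl -!scaler_nat; apply: scalerI.
by rewrite pnatr_eq0.
Qed.

(** The recurrence of the Gegenbauer polynomials transfers coefficientwise.  In
    the middle term the shift of the degree absorbs a factor s; in the last one
    the two extra coefficients vanish, which leaves a factor q. *)
Lemma zonal_sequenceP (R : realType) (B : comAlgType R) (p : nat) (s q : B) :
  zonal_sequence p s q (zonal p s q).
Proof.
split=> [||k]; rewrite /zonal.
- by rewrite big_ord1 coef1 scale1r expr0 mul1r.
- rewrite big_ord_recl big_ord1 /= !coefX /= scale0r add0r scale1r expr1.
  by rewrite expr0 mulr1.
set c : R := (k + p + 1)%:R.
have c0 : c != 0 by rewrite /c addn1 pnatr_eq0.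
have gS j : c * (gegenbauer p.+2 k.+2 : {poly R})`_j =
    (2 * k + p + 2)%:R * ('X * gegenbauer p.+2 k.+1 : {poly R})`_j
    - (k + 1)%:R * (gegenbauer p.+2 k : {poly R})`_j.
  rewrite [gegenbauer _ k.+2]/= coefZ coefB !coefZ mulrA.
  rewrite (_ : k.+2 + p.+2 - 3 = k + p + 1)%N; last by lia.
  rewrite (_ : 2 * k.+2 + p.+2 - 4 = 2 * k + p + 2)%N; last by lia.
  rewrite (_ : k.+2 - 1 = k + 1)%N; last by lia.
  by rewrite mulfV // mul1r.
transitivity (\sum_(j < k.+3)
   ((2 * k + p + 2)%:R * ('X * gegenbauer p.+2 k.+1 : {poly R})`_j) *:
      (s ^+ j * q ^+ (k.+2 - j)./2)
  - \sum_(j < k.+3) ((k + 1)%:R * (gegenbauer p.+2 k : {poly R})`_j) *: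
      (s ^+ j * q ^+ (k.+2 - j)./2)).
  rewrite -sumrB mulr_natl -scaler_nat scaler_sumr; apply: eq_bigr => j _.
  by rewrite scalerA gS scalerBl.
congr (_ - _).
  rewrite big_ord_recl coefXM eqxx mulr0 scale0r add0r.
  rewrite mulr_sumr mulr_natl -scaler_nat scaler_sumr; apply: eq_bigr => j _.
  by rewrite coefXM /= -scalerA /bump /= add1n subSS exprS -mulrA scalerAr.
rewrite 2!big_ord_recr /= !gegenbauer_coef_eq0 ?ltnS ?leqnn ?leqnSn //.
rewrite !mulr0 !scale0r !addr0 mulr_sumr mulr_natl -scaler_nat scaler_sumr.
apply: eq_bigr => j _.
have jk : (j <= k)%N by rewrite -ltnS.
by rewrite -scalerA -scalerAr mulrCA !subSn ?(leqW jk) //= exprS.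
Qed.

(** * Polynomials in two groups of variables *)

Section LinearEmbedding.

Variables (R : realType) (d n : nat).

Definition rename_mpoly (e : 'I_d -> 'I_n) (f : {mpoly R[d]}) : {mpoly R[n]} :=
  f \mPo [tuple 'X_(e i) | i < d].

Lemma rename_mpolyC e c : rename_mpoly e c%:MP = c%:MP.
Proof. exact: comp_mpolyC. Qed.

Lemma rename_mpolyD e : {morph rename_mpoly e : f g / f + g}.
Proof. exact: comp_mpolyD. Qed.

Lemma rename_mpolyB e : {morph rename_mpoly e : f g / f - g}.
Proof. exact: comp_mpolyB. Qed.

Lemma rename_mpolyM e : {morph rename_mpoly e : f g / f * g}.
Proof. by move=> f g; apply: rmorphM. Qed.

Lemma rename_mpolyZ e c f : rename_mpoly e (c *: f) = c *: rename_mpoly e f.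
Proof. exact: comp_mpolyZ. Qed.

Lemma rename_mpoly_sum e (I : Type) (r : seq I) (F : I -> {mpoly R[d]}) :
  rename_mpoly e (\sum_(i <- r) F i) = \sum_(i <- r) rename_mpoly e (F i).
Proof. exact: raddf_sum. Qed.

Lemma rename_mpolyXU e i : rename_mpoly e 'X_i = 'X_(e i).
Proof. by rewrite /rename_mpoly comp_mpolyXU -tnth_nth tnth_mktuple. Qed.

Lemma mderiv_derivation N (i : 'I_N) : derivation (@mderiv N R i).
Proof. by split=> f g; [rewrite mderivB | rewrite mderivM]. Qed.

Lemma mderivXU N (i j : 'I_N) : ('X_j : {mpoly R[N]})^`M(i) = (j == i)%:R.
Proof.
rewrite mderivX mnm1E; case: eqP => [->|_]; last by rewrite scale0r.
rewrite (_ : (U_(i) - U_(i))%MM = 0%MM) ?mpolyX0 ?scale1r //.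
by apply/mnmP => l; rewrite mnmBE subnn mnm0E.
Qed.

(** Chain rule for a substitution of variables by variables.  Both sides are
    derivations along the renaming morphism, so it is enough to compare them on
    constants and on variables. *)
Lemma mderiv_rename e (k : 'I_n) f :
  (rename_mpoly e f)^`M(k)
    = \sum_j rename_mpoly e f^`M(j) * (e j == k)%:R.
Proof.
pose Q f := (rename_mpoly e f)^`M(k)
    = \sum_j rename_mpoly e f^`M(j) * (e j == k)%:R.
have QC c : Q c%:MP.
  rewrite /Q rename_mpolyC mderivC big1 // => j _.
  by rewrite mderivC rename_mpolyC mpolyC0 mul0r.
have QM g h : Q g -> Q h -> Q (g * h).
  rewrite /Q rename_mpolyM mderivM => -> ->.
  rewrite mulr_suml mulr_sumr -big_split; apply: eq_bigr => j _ /=.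
  by rewrite mderivM rename_mpolyD !rename_mpolyM; ring.
have QX i : Q 'X_i.
  rewrite /Q rename_mpolyXU mderivXU (bigD1 i) //= mderivXU eqxx.
  rewrite -mpolyC1 rename_mpolyC mpolyC1 mul1r big1 ?addr0 // => j ji.
  by rewrite mderivXU eq_sym (negbTE ji) -mpolyC0 rename_mpolyC mpolyC0 mul0r.
rewrite -/(Q f); elim/mpolyind: f => [|c m f _ _ IHf]; first exact: (QC 0).
have Qm : Q 'X_[m].
  rewrite mpolyXE_id; apply: big_ind => [|//|i _]; first exact: (QC 1).
  elim: (m i) => [|N IHN]; first exact: (QC 1).
  by rewrite exprS; apply: QM.
have := QM _ _ (QC c) Qm; rewrite mul_mpolyC /Q => Qcm.
rewrite rename_mpolyD mderivD IHf Qcm -big_split.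
by apply: eq_bigr => j _ /=; rewrite mderivD rename_mpolyD mulrDl.
Qed.

Variable P : 'M[R]_d.

(** The coordinates of Px, and below the components of P grad, in the group of
    variables selected by e. *)
Definition proj_var (e : 'I_d -> 'I_n) (i : 'I_d) : {mpoly R[n]} :=
  \sum_j P i j *: 'X_(e j).

Definition proj_deriv (e : 'I_d -> 'I_n) (i : 'I_d) (f : {mpoly R[n]}) :
    {mpoly R[n]} :=
  \sum_j (P i j)%:MP * f^`M(e j).

Lemma proj_deriv_derivation e i : derivation (proj_deriv e i).
Proof. by apply: derivation_lincomb => j; apply: mderiv_derivation. Qed.

End LinearEmbedding.

Section RenamedProjection.

Variables (R : realType) (d n : nat) (P : 'M[R]_d).

Lemma rename_proj_var (e : 'I_d -> 'I_n) i :
  rename_mpoly e (proj_var P id i) = proj_var P e i.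
Proof.
rewrite /proj_var rename_mpoly_sum; apply: eq_bigr => j _.
by rewrite rename_mpolyZ rename_mpolyXU.
Qed.

Lemma proj_deriv_rename (e : 'I_d -> 'I_n) i f : injective e ->
  proj_deriv P e i (rename_mpoly e f) = rename_mpoly e (proj_deriv P id i f).
Proof.
move=> eI; rewrite /proj_deriv rename_mpoly_sum.
apply: eq_bigr => j _; rewrite rename_mpolyM rename_mpolyC.
rewrite mderiv_rename (bigD1 j) //= eqxx mulr1 big1 ?addr0 //.
  by move=> l lj; rewrite (inj_eq eI) (negbTE lj) mulr0.
Qed.

Lemma proj_deriv_rename0 (e e' : 'I_d -> 'I_n) i f :
  (forall j l, e j != e' l) -> proj_deriv P e i (rename_mpoly e' f) = 0.
Proof.
move=> ee'; rewrite /proj_deriv big1 // => j _.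
rewrite mderiv_rename big1 ?mulr0 // => l _.
by rewrite eq_sym (negbTE (ee' _ _)) mulr0.
Qed.

Hypotheses (Psym : P^T = P) (Pidem : P *m P = P).

Lemma proj_deriv_var (e : 'I_d -> 'I_n) i j : injective e ->
  proj_deriv P e i (proj_var P e j) = (P i j)%:MP.
Proof.
move=> eI; rewrite -[P in RHS]Pidem mxE rmorph_sum /=; apply: eq_bigr => l _.
rewrite rmorphM; congr (_ * _).
rewrite /proj_var (derivation_sum (mderiv_derivation _ _)) (bigD1 l) //= big1.
  by rewrite mderivZ mderivXU eqxx addr0 -[P in RHS]Psym mxE -mul_mpolyC mulr1.
move=> h hl; rewrite mderivZ mderivXU (inj_eq eI) (negbTE hl).
by rewrite scaler0.
Qed.

Lemma proj_var_proj (e : 'I_d -> 'I_n) i :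
  \sum_j (P i j)%:MP * proj_var P e j = proj_var P e i.
Proof.
rewrite /proj_var; under eq_bigr do rewrite mul_mpolyC scaler_sumr.
rewrite exchange_big; apply: eq_bigr => l _ /=.
rewrite -[P in RHS]Pidem mxE scaler_suml; apply: eq_bigr => j _.
by rewrite scalerA.
Qed.

End RenamedProjection.

(** * The zonal kernel as a sum of products *)

Section ZonalKernel.

Let pull_l (B : comNzRingType) (n a b c e f : B) :
  n * (a * (b * c)) - e * (0 * c + b * f) = b * (n * (a * c) - e * f).
Proof. by ring. Qed.

Let pull_r (B : comNzRingType) (n a b c e f : B) :
  n * (a * (b * c)) - e * (f * c + b * 0) = (n * (a * b) - e * f) * c.
Proof. by ring. Qed.

Variables (R : realType) (d p : nat) (P : 'M[R]_d).
Hypotheses (Psym : P^T = P) (Pidem : P *m P = P) (trP : \tr P = (p + 2)%:R).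

Let eL := @lshift d d.
Let eR := @rshift d d.
Let x := proj_var P eL.
Let y := proj_var P eR.
Let s := \sum_i x i * y i.
Let X := \sum_i x i * x i.
Let Y := \sum_i y i * y i.
Let u := proj_var P id.
Let U := \sum_i u i * u i.

Let lr i j : eL i != eR j. Proof. by rewrite eq_lrshift. Qed.
Let rl i j : eR i != eL j. Proof. by rewrite eq_rlshift. Qed.

Let raise (N : nat) (i : 'I_d) (h : {mpoly R[d]}) : {mpoly R[d]} :=
  N%:R * (u i * h) - U * proj_deriv P id i h.

Let rename_raise (e : 'I_d -> 'I_(d + d)) N i h : injective e ->
  rename_mpoly e (raise N i h) =
    N%:R * (proj_var P e i * rename_mpoly e h)
    - (\sum_j proj_var P e j * proj_var P e j)
      * proj_deriv P e i (rename_mpoly e h).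
Proof.
move=> eI; rewrite /raise rename_mpolyB !rename_mpolyM rename_proj_var.
rewrite -mpolyC_nat rename_mpolyC -proj_deriv_rename // rename_mpoly_sum.
rewrite mpolyC_nat; congr (_ - _ * _); apply: eq_bigr => j _.
by rewrite rename_mpolyM rename_proj_var.
Qed.

(** The induction step applies the raising operators in both groups of
    variables at once.  Since the gradient in one group annihilates polynomials
    in the other, they act factorwise on h(x) h(y). *)
Lemma zonal_sum_of_products k :
  exists (J : seq {mpoly R[d]}) (c : nat), (0 < c)%N /\
    c%:R * zonal p s (X * Y) k
      = \sum_(h <- J) rename_mpoly eL h * rename_mpoly eR h.
Proof.
have [Z0 Z1 _] := zonal_sequenceP p s (X * Y).
elim: k => [|k [J [c [c0 IHk]]]].
  exists [:: 1], 1%N; split=> //.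
  by rewrite Z0 big_seq1 -mpolyC1 !rename_mpolyC mulr1.
(* For k = 0 and n = 2 the factor N (k + n - 2) of the raising identity is
   zero, so degree 1 is treated by hand: Z_1 = x . y. *)
case: (posnP k) => [->|k0].
  exists [seq u i | i : 'I_d], 1%N; split=> //.
  rewrite Z1 mul1r big_image /=; apply: eq_bigr => i _.
  by rewrite !rename_proj_var.
have [IL IR] : injective eL /\ injective eR.
  by split; [apply: lshift_inj | apply: rshift_inj].
pose N := (2 * k + p)%N.
exists [seq raise N i h | i <- index_enum 'I_d, h <- J], (c * (N * (k + p)))%N.
split; first by rewrite !muln_gt0 c0 /N; lia.
rewrite big_allpairs_dep natrM -mulrA.
rewrite -(@zonal_raise _ _ (fun i j => (P i j)%:MP) x y (proj_deriv P eL)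
  (proj_deriv P eR)) //; first last.
- exact: zonal_sequenceP.
- exact: alg_natI.
- by rewrite -(mpolyC_nat _ R) -trP /mxtrace rmorph_sum.
- by move=> i; apply: proj_var_proj.
- by move=> i; apply: proj_var_proj.
- by move=> i j; apply: proj_deriv_var.
- move=> i j; rewrite /x -rename_proj_var; exact: proj_deriv_rename0.
- move=> i j; rewrite /y -rename_proj_var; exact: proj_deriv_rename0.
- by move=> i j; apply: proj_deriv_var.
- by move=> i; apply: proj_deriv_derivation.
- by move=> i; apply: proj_deriv_derivation.
rewrite mulr_sumr; apply: eq_bigr => i _.
have derL := proj_deriv_derivation P eL i.
have derR := proj_deriv_derivation P eR i.
have [DLB DLM] := derL; have [DRB DRM] := derR.
pose Ly f := N%:R * (y i * f) - Y * proj_deriv P eR i f.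
pose Lx f := N%:R * (x i * f) - X * proj_deriv P eL i f.
rewrite -/(Ly _) -/(Lx _).
transitivity (Lx (Ly (c%:R * zonal p s (X * Y) k))).
  have -> f : Ly (c%:R * f) = c%:R * Ly f.
    by rewrite /Ly (derivation_natM derR); ring.
  by rewrite /Lx (derivation_natM derL); ring.
have LyD : {morph Ly : f g / f + g}.
  by move=> f g; rewrite /Ly (derivationD derR); ring.
have LxD : {morph Lx : f g / f + g}.
  by move=> f g; rewrite /Lx (derivationD derL); ring.
have Ly0 : Ly 0 = 0 by rewrite /Ly (derivation0 derR); ring.
have Lx0 : Lx 0 = 0 by rewrite /Lx (derivation0 derL); ring.
rewrite IHk (big_morph Ly LyD Ly0) (big_morph Lx LxD Lx0).
apply: eq_bigr => h _.
have -> : Ly (rename_mpoly eL h * rename_mpoly eR h)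
    = rename_mpoly eL h * rename_mpoly eR (raise N i h).
  rewrite rename_raise // /Ly DRM proj_deriv_rename0 // -/y -/Y; exact: pull_l.
rewrite [rename_mpoly eL (raise _ _ _)]rename_raise // /Lx DLM.
rewrite (proj_deriv_rename0 _ (e := eL) (e' := eR)) // -/x -/X; exact: pull_r.
Qed.

(** The previous identity evaluated at pairs of vectors: Schoenberg's theorem on
    the range of a projection of rank p + 2, in the form of an explicit feature
    map. *)
Lemma zonal_kernel_sum_of_products k :
  exists (J : seq ('cV[R]_d -> R)) (c : R), 0 < c /\
    forall a b : 'cV[R]_d,
      c * zonal p ((a^T *m P *m b) 0 0 : R^o)
            ((a^T *m P *m a) 0 0 * (b^T *m P *m b) 0 0) k
        = \sum_(h <- J) h a * h b.
Proof.
have [J [c [c0 cJ]]] := zonal_sum_of_products k.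
exists [seq (fun a : 'cV[R]_d => h.@[fun i => a i 0]) | h : {mpoly R[d]} <- J].
exists c%:R.
split; first by rewrite ltr0n.
move=> a b; rewrite big_map.
pose v (l : 'I_(d + d)) := match split l with inl i => a i 0 | inr i => b i 0 end.
have vL i : v (eL i) = a i 0.
  by rewrite /v (unsplitK (inl i : 'I_d + 'I_d)).
have vR i : v (eR i) = b i 0.
  by rewrite /v (unsplitK (inr i : 'I_d + 'I_d)).
have meval_rename e h : (rename_mpoly e h).@[v] = h.@[fun i => v (e i)].
  rewrite /rename_mpoly comp_mpoly_meval; apply: meval_eq => i.
  by rewrite tnth_mktuple mevalXU.
transitivity (\sum_(h <- J) (rename_mpoly eL h * rename_mpoly eR h).@[v]); last first.
  apply: eq_bigr => h _; rewrite mevalM !meval_rename.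
  by congr (_ * _); apply: meval_eq.
have mevalx i : (x i).@[v] = (P *m a) i 0.
  rewrite /x /proj_var raddf_sum mxE; apply: eq_bigr => j _ /=.
  by rewrite mevalZ mevalXU vL.
have mevaly i : (y i).@[v] = (P *m b) i 0.
  rewrite /y /proj_var raddf_sum mxE; apply: eq_bigr => j _ /=.
  by rewrite mevalZ mevalXU vR.
have form a' b' : (a'^T *m P *m b') 0 0 = \sum_i (P *m a') i 0 * (P *m b') i 0.
  rewrite -[in LHS]Pidem mulmxA -mulmxA -[X in _ *m X *m (P *m _)]Psym -trmx_mul mxE.
  by apply: eq_bigr => i _; rewrite mxE.
rewrite -raddf_sum -cJ /= mevalM -mpolyC_nat mevalC; congr (_ * _).
rewrite /zonal raddf_sum; apply: eq_bigr => j _ /=.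
rewrite mevalZ mevalM !rmorphXn /= mevalM /s /X /Y !raddf_sum /= !form.
congr (_ * (_ ^+ _ * (_ * _) ^+ _)); apply: eq_bigr => i _;
  by rewrite mevalM ?mevalx ?mevaly.
Qed.

End ZonalKernel.

(** * Points on the sphere and their Gram matrices *)

Section Dotv.

Variables (R : realType) (d : nat).
Implicit Types x y : 'cV[R]_d.

Lemma dotvE x y : dotv x y = \sum_i x i 0 * y i 0.
Proof. by rewrite /dotv mxE; apply: eq_bigr => i _; rewrite mxE. Qed.

Lemma dotvC x y : dotv x y = dotv y x.
Proof. by rewrite !dotvE; apply: eq_bigr => i _; rewrite mulrC. Qed.

Lemma dotv_ge0 x : 0 <= dotv x x.
Proof. by rewrite dotvE sumr_ge0 // => i _; rewrite -expr2 sqr_ge0. Qed.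

Lemma dotv_eq0 x : dotv x x = 0 -> x = 0.
Proof.
rewrite dotvE => /eqP; rewrite psumr_eq0 => [/allP h|i _].
  apply/colP => i; apply/eqP; have := h i (mem_index_enum _).
  by rewrite mxE -expr2 sqrf_eq0.
by rewrite -expr2 sqr_ge0.
Qed.

(** Equality in the Cauchy-Schwarz inequality: |x - y|^2 = 2 - 2 x . y. *)
Lemma dotv_eq1 x y : dotv x x = 1 -> dotv y y = 1 -> dotv x y = 1 -> x = y.
Proof.
move=> xx yy xy; apply/eqP; rewrite -subr_eq0; apply/eqP/dotv_eq0.
have -> : dotv (x - y) (x - y) = dotv x x - dotv x y *+ 2 + dotv y y.
  rewrite !dotvE -sumrMnl -sumrN -!big_split /=.
  by apply: eq_bigr => i _; rewrite !mxE; ring.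
by rewrite xx yy xy; ring.
Qed.

End Dotv.

Section SphereInnerProducts.

Variables (R : realType) (d : nat) (X : {fset 'cV[R]_d}).
Hypothesis sX : on_sphere X.

Lemma dotv_in (c c' : X) :
  c != c' -> dotv (val c) (val c') \in inner_products X.
Proof.
move=> cc'; apply/imfset2P; exists (val c); first exact: valP.
by exists (val c') => //; rewrite inE; apply/andP; split; [exact: valP|].
Qed.

Lemma inner_products_neq1 : 1 \notin inner_products X.
Proof.
apply/negP => /imfset2P[/= x xX [y]]; rewrite inE => /andP[yX xy] e.
by move: xy; rewrite (@dotv_eq1 _ _ x y) ?eqxx // sX.
Qed.

Lemma dotv_in1 (c c' : X) : dotv (val c) (val c') \in inner_products1 X.
Proof.
rewrite in_fsetU; have [->|/dotv_in -> //] := eqVneq c c'.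
by rewrite (sX (fsvalP c')) !inE eqxx orbT.
Qed.

End SphereInnerProducts.

Section Gram.

Variables (R : realType).

Lemma posdef_unitmx m (G : 'M[R]_m) : posdef G -> G \in unitmx.
Proof.
case=> _ posG; rewrite -row_free_unit -kermx_eq0; apply/eqP.
apply/row_matrixP => i; rewrite row0; apply/eqP/negP => /negP ni.
have := posG (row i (kermx G))^T; rewrite trmx_eq0 => /(_ ni).
by rewrite trmxK -row_mul mulmx_ker row0 mul0mx mxE ltxx.
Qed.

Definition colsmx d m (b : 'I_m -> 'cV[R]_d) : 'M[R]_(d, m) :=
  \matrix_(i, j) b j i 0.

Lemma colsmx_gram d m (b : 'I_m -> 'cV[R]_d) :
  (colsmx b)^T *m colsmx b = gram b.
Proof.
apply/matrixP => i j; rewrite !mxE dotvE; apply: eq_bigr => l _.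
by rewrite !mxE.
Qed.

(** x^T G x is the squared length of the combination of the b_i with
    coefficients x. *)
Lemma gram_free_posdef d m (b : 'I_m -> 'cV[R]_d) :
  free [seq b i | i : 'I_m] -> posdef (gram b).
Proof.
move=> fb; split.
  by apply/matrixP => i j; rewrite !mxE dotvC.
move=> x x0; rewrite -colsmx_gram mulmxA -trmx_mul -mulmxA.
rewrite -[X in 0 < X]/(dotv (colsmx b *m x) (colsmx b *m x)).
rewrite lt_neqAle dotv_ge0 andbT eq_sym; apply/negP => /eqP/dotv_eq0 bx.
case/negP: x0; apply/eqP/colP => i; rewrite [RHS]mxE.
pose t := [tuple b i | i < m].
have ft : free t by rewrite /t /=.
have /freeP ht := ft.
apply: (ht (fun i => x i 0)).
apply/colP => l; move/colP: bx => /(_ l) bx.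
rewrite -[RHS]bx summxE mxE; apply: eq_bigr => j _.
have -> : t`_j = b j by rewrite -tnth_nth tnth_mktuple.
by rewrite !mxE mulrC.
Qed.

Section Bordered.

Variables (d m : nat).

Definition inner_col (b : 'I_m -> 'cV[R]_d) (c : 'cV[R]_d) : 'cV[R]_m :=
  \col_i dotv (b i) c.

Definition next_to_last : 'I_(m + 2) := rshift m (lshift 1 (ord0 : 'I_1)).
Definition last_index : 'I_(m + 2) := rshift m (rshift 1 (ord0 : 'I_1)).

Lemma gram_bordered (w : 'I_(m + 2) -> 'cV[R]_d) :
  (forall i, dotv (w i) (w i) = 1) ->
  let b := w \o lshift 2 in let c := w next_to_last in let c' := w last_index in
  gram w = bordered (gram b) (inner_col b c) (inner_col b c') (dotv c c').
Proof.
move=> w1 b c c'; rewrite -[LHS](@submxK _ m (1 + 1) m (1 + 1)).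
rewrite /bordered; congr block_mx.
- by apply/matrixP => i j; rewrite !mxE.
- apply/matrixP => i j; rewrite !mxE.
  by case: (@split_ordP 1 1 j) => l ->; rewrite !mxE ord1.
- apply/matrixP => i j; rewrite !mxE.
  by case: (@split_ordP 1 1 i) => l ->; rewrite !mxE ord1 dotvC.
- apply/matrixP => i j; rewrite !mxE.
  case: (@split_ordP 1 1 i) => k ->; case: (@split_ordP 1 1 j) => l ->;
    rewrite ?(block_mxEul, block_mxEur, block_mxEdl, block_mxEdr);
    rewrite ?(ord1 k) ?(ord1 l) !mxE.
- by rewrite (unsplitK (inl ord0 : 'I_1 + 'I_1)) mxE w1.
- by rewrite (unsplitK (inr ord0 : 'I_1 + 'I_1)) mxE.
- by rewrite (unsplitK (inl ord0 : 'I_1 + 'I_1)) mxE dotvC.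
- by rewrite (unsplitK (inr ord0 : 'I_1 + 'I_1)) mxE w1.
Qed.

Lemma bordered_eq (G G' : 'M[R]_m) (u v u' v' : 'cV[R]_m) (t t' : R) :
  (bordered G u v t == bordered G' u' v' t')
    = [&& G == G', u == u', v == v' & t == t'].
Proof.
apply/eqP/and4P => [|[/eqP -> /eqP -> /eqP -> /eqP -> //]].
case/eq_block_mx => -> /eq_row_mx[-> ->] _ /eq_block_mx[_ /matrixP/(_ 0 0)].
by rewrite !mxE eqxx !mulr1n => -> _ _.
Qed.

End Bordered.

End Gram.

(** * Orthogonal projection along a tuple *)

Section OrthogonalProjection.

Variables (R : realType) (d m : nat) (b : 'I_m -> 'cV[R]_d).
Hypothesis Gunit : gram b \in unitmx.

(** The projection onto the orthogonal complement of the span of b. *)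
Definition orth_proj : 'M[R]_d :=
  1%:M - colsmx b *m invmx (gram b) *m (colsmx b)^T.

Lemma gram_sym : (gram b)^T = gram b.
Proof. by rewrite -colsmx_gram trmx_mul trmxK. Qed.

Lemma orth_proj_sym : orth_proj^T = orth_proj.
Proof.
rewrite /orth_proj linearB /= trmx1 !trmx_mul trmxK trmx_inv gram_sym.
by rewrite mulmxA.
Qed.

Lemma orth_proj_idem : orth_proj *m orth_proj = orth_proj.
Proof.
rewrite {1}/orth_proj mulmxBl mul1mx -[RHS]subr0; congr (_ - _).
rewrite /orth_proj mulmxBr mulmx1 !mulmxA.
rewrite -[_ *m (colsmx b)^T *m colsmx b]mulmxA colsmx_gram.
by rewrite mulmxKV // subrr.
Qed.

Lemma orth_proj_trace : (m <= d)%N -> \tr orth_proj = (d - m)%:R.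
Proof.
move=> md; rewrite /orth_proj linearB /= mxtrace1 mxtrace_mulC mulmxA colsmx_gram.
by rewrite mulmxV // mxtrace1 natrB.
Qed.

Lemma orth_proj_gramres (x y : 'cV[R]_d) :
  (x^T *m orth_proj *m y) 0 0
    = gramres (gram b) (inner_col b x) (inner_col b y) (dotv x y).
Proof.
have bE z : inner_col b z = (colsmx b)^T *m z.
  apply/colP => i; rewrite !mxE dotvE; apply: eq_bigr => l _.
  by rewrite !mxE.
rewrite /gramres !bE /orth_proj mulmxBr mulmx1 mulmxBl mxE; congr (_ + _).
by rewrite mxE trmx_mul trmxK !mulmxA.
Qed.

End OrthogonalProjection.

(** * Positive semidefinite matrices *)

Section PossemidefClosure.

Variables (R : realType) (n : nat).

Lemma possemidef_outer (v : 'cV[R]_n) : possemidef (v *m v^T).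
Proof.
split=> [|x]; first by rewrite trmx_mul trmxK.
have -> : x^T *m (v *m v^T) *m x = (v^T *m x)^T *m (v^T *m x).
  by rewrite trmx_mul trmxK !mulmxA.
exact: dotv_ge0.
Qed.

Lemma possemidef0 : possemidef (0 : 'M[R]_n).
Proof. by split=> [|x]; rewrite ?trmx0 // mulmx0 mul0mx mxE. Qed.

Lemma possemidefD (M N : 'M[R]_n) :
  possemidef M -> possemidef N -> possemidef (M + N).
Proof.
move=> [sM pM] [sN pN]; split=> [|x]; first by rewrite linearD /= sM sN.
by rewrite mulmxDr mulmxDl mxE addr_ge0.
Qed.

Lemma possemidefZ (c : R) (M : 'M[R]_n) :
  0 <= c -> possemidef M -> possemidef (c *: M).
Proof.
move=> c0 [sM pM]; split=> [|x]; first by rewrite linearZ /= sM.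
by rewrite -scalemxAr -scalemxAl mxE mulr_ge0.
Qed.

Lemma possemidef_sum (I : Type) (r : seq I) (Q : pred I) (M : I -> 'M[R]_n) :
  (forall i, Q i -> possemidef (M i)) -> possemidef (\sum_(i <- r | Q i) M i).
Proof.
move=> pM; apply: big_ind => //; [exact: possemidef0 | exact: possemidefD].
Qed.

End PossemidefClosure.

(** A kernel that is a sum of products h(x) h(y) turns the matrix into a sum of
    outer products w w^T with w = sum_i h(x_i) e_i. *)
Lemma possemidef_gegenbauer (R : realType) (d m k n : nat)
    (b : 'I_m -> 'cV[R]_d) (I : finType) (x : I -> 'cV[R]_d)
    (e : I -> 'cV[R]_n) :
  (m + 2 <= d)%N -> posdef (gram b) -> (forall i, dotv (x i) (x i) = 1) ->
  possemidef (\sum_i \sum_j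
    Qgegenbauer d k (gram b) (inner_col b (x i)) (inner_col b (x j))
      (dotv (x i) (x j)) *: (e i *m (e j)^T)).
Proof.
move=> md /posdef_unitmx Gu x1.
pose p := (d - m - 2)%N.
have dm : (d - m = p.+2)%N by rewrite /p; lia.
have trP : \tr (orth_proj b) = (p + 2)%:R.
  by rewrite orth_proj_trace ?dm ?addn2 //; lia.
have [J [c [c0 cJ]]] := zonal_kernel_sum_of_products
  (orth_proj_sym b) (orth_proj_idem Gu) trP k.
have -> : \sum_i \sum_j
    Qgegenbauer d k (gram b) (inner_col b (x i)) (inner_col b (x j))
      (dotv (x i) (x j)) *: (e i *m (e j)^T) =
    c^-1 *: \sum_(h <- J) (\sum_i h (x i) *: e i) *m (\sum_i h (x i) *: e i)^T.
  apply: (canRL (scalerK (lt0r_neq0 c0))); rewrite scaler_sumr.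
  under [RHS]eq_bigr => h _.
    rewrite linear_sum mulmx_suml.
    under eq_bigr => i _ do rewrite mulmx_sumr.
    over.
  rewrite exchange_big; apply: eq_bigr => i _ /=.
  rewrite scaler_sumr exchange_big; apply: eq_bigr => j _ /=.
  under eq_bigr => h _ do
    rewrite linearZ /= -scalemxAr -scalemxAl scalerA mulrC.
  rewrite -scaler_suml -cJ scalerA; congr (_ *: _); congr (_ * _).
  rewrite /Qgegenbauer /zonal dm !orth_proj_gramres !x1.
  by apply: eq_bigr => l _; rewrite -mulrA.
apply: possemidefZ; first by rewrite invr_ge0 ltW.
by apply: possemidef_sum => h _; apply: possemidef_outer.
Qed.

(** * Counting tuples with a given Gram matrix *)

Section Counting.

Variables (R : realType) (d m : nat) (X : {fset 'cV[R]_d}).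
Hypothesis sX : on_sphere X.
Implicit Types (w : {ffun 'I_(m + 2) -> X}) (b : {ffun 'I_m -> X}) (c : X).

Lemma gram_eq_bordered w (G : 'M[R]_m) (u v : 'cV[R]_m) (t : R) :
  (gram (fun i => val (w i)) == bordered G u v t) =
  let b i := val (w (lshift 2 i)) in
  let c := val (w (next_to_last m)) in let c' := val (w (last_index m)) in
  [&& gram b == G, inner_col b c == u, inner_col b c' == v & dotv c c' == t].
Proof.
rewrite gram_bordered ?bordered_eq // => i.
exact: (sX (fsvalP (w i))).
Qed.

Definition extend_tuple b c c' : {ffun 'I_(m + 2) -> X} :=
  [ffun i => match split i with
             | inl j => b j
             | inr k => if k == 0 then c else c'
             end].

Lemma extend_tuple_head b c c' i : extend_tuple b c c' (lshift 2 i) = b i.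
Proof. by rewrite ffunE (unsplitK (inl i : 'I_m + 'I_2)). Qed.

Lemma extend_tuple_next b c c' : extend_tuple b c c' (next_to_last m) = c.
Proof.
by rewrite ffunE (unsplitK (inr (lshift 1 (ord0 : 'I_1)) : 'I_m + 'I_2)).
Qed.

Lemma extend_tuple_last b c c' : extend_tuple b c c' (last_index m) = c'.
Proof.
by rewrite ffunE (unsplitK (inr (rshift 1 (ord0 : 'I_1)) : 'I_m + 'I_2)).
Qed.

Lemma extend_tuple_bij :
  bijective (fun q : {ffun 'I_m -> X} * (X * X) => extend_tuple q.1 q.2.1 q.2.2).
Proof.
exists (fun w => ([ffun i => w (lshift 2 i)],
                  (w (next_to_last m), w (last_index m)))).
  case=> b [c c'] /=; rewrite extend_tuple_next extend_tuple_last.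
  by congr (_, _); apply/ffunP => i; rewrite ffunE extend_tuple_head.
move=> w; apply/ffunP => i /=; case: (split_ordP i) => j ->.
  by rewrite extend_tuple_head ffunE.
case: (@split_ordP 1 1 j) => k ->; rewrite ord1.
  by rewrite [LHS]extend_tuple_next.
by rewrite [LHS]extend_tuple_last.
Qed.

Lemma Ncount_sum (G : 'M[R]_m) (u v : 'cV[R]_m) (t : R) :
  Ncount X G u v t =
  (\sum_(b : {ffun 'I_m -> X} | gram (fun i => val (b i)) == G)
    \sum_(c : X) \sum_(c' : X)
     [&& inner_col (fun i => val (b i)) (val c) == u,
         inner_col (fun i => val (b i)) (val c') == v
       & dotv (val c) (val c') == t])%N.
Proof.
rewrite /Ncount -sum1dep_card big_mkcond (reindex _ (onW_bij _ extend_tuple_bij)).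
transitivity (\sum_(b : {ffun 'I_m -> X}) \sum_(c : X) \sum_(c' : X)
    (gram (fun i => val (extend_tuple b c c' i)) == bordered G u v t))%N.
  under [RHS]eq_bigr do rewrite pair_bigA.
  by rewrite pair_bigA; apply: eq_bigr => q _ /=; case: (_ == _).
rewrite [RHS]big_mkcond; apply: eq_bigr => b _.
have eG c c' : (gram (fun i => val (extend_tuple b c c' i)) == bordered G u v t)
    = (gram (fun i => val (b i)) == G)
      && [&& inner_col (fun i => val (b i)) (val c) == u,
         inner_col (fun i => val (b i)) (val c') == v
       & dotv (val c) (val c') == t].
  rewrite gram_eq_bordered /= extend_tuple_next extend_tuple_last.
  rewrite (_ : (fun i => val (extend_tuple b c c' (lshift 2 i)))
    = (fun i => val (b i))) //.
  by apply: funext => i; rewrite extend_tuple_head.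
case: eqP eG => _ eG.
  by apply: eq_bigr => c _; apply: eq_bigr => c' _; rewrite eG.
by rewrite big1 // => c _; rewrite big1 // => c' _; rewrite eG.
Qed.

End Counting.

(** * Decomposition of the matrix *)

Lemma exchange_big_triple (V : nmodType) (I J K L : finType) (Q : pred L)
    (F : I -> J -> K -> L -> V) :
  \sum_i \sum_j \sum_k \sum_(l | Q l) F i j k l
    = \sum_(l | Q l) \sum_i \sum_j \sum_k F i j k l.
Proof.
rewrite [RHS]exchange_big; apply: eq_bigr => i _ /=.
rewrite [RHS]exchange_big; apply: eq_bigr => j _ /=.
by rewrite exchange_big.
Qed.

Section Qmatrix.

Variables (R : realType) (d m : nat) (X : {fset 'cV[R]_d}).
Hypothesis sX : on_sphere X.

Let ip (c c' : X) : inner_products1 X := [` dotv_in1 sX c c']%fset.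

Let val_ip c c' : val (ip c c') = dotv (val c) (val c'). Proof. by []. Qed.

Let ip_col (b : {ffun 'I_m -> X}) (c : X) : 'cV[inner_products1 X]_m :=
  \col_i ip (b i) c.

Let val_ip_col b c : map_mx val (ip_col b c) = inner_col (fun i => val (b i)) (val c).
Proof. by apply/colP => i; rewrite !mxE. Qed.

Let map_val_inj : injective (map_mx val : 'cV[inner_products1 X]_m -> 'cV[R]_m).
Proof.
move=> u v /colP uv; apply/colP => i; apply: val_inj.
by have := uv i; rewrite !mxE.
Qed.

(** Each triple (b, c, c') with gram b = G contributes to exactly one index
    (u, v, t) of the sum defining the matrix, the one read off from its inner
    products. *)
Lemma Qmatrix_sum (G : 'M[R]_m) (k : nat) :
  Qmatrix k G X = \sum_(b : {ffun 'I_m -> X} | gram (fun i => val (b i)) == G)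
    \sum_(c : X) \sum_(c' : X)
      Qgegenbauer d k (gram (fun i => val (b i)))
        (inner_col (fun i => val (b i)) (val c))
        (inner_col (fun i => val (b i)) (val c')) (dotv (val c) (val c'))
      *: (basis_vec (ip_col b c) *m (basis_vec (ip_col b c'))^T).
Proof.
rewrite /Qmatrix.
transitivity (\sum_(u : 'cV[inner_products1 X]_m)
  \sum_(v : 'cV[inner_products1 X]_m)
  \sum_(t : inner_products1 X)
  \sum_(b : {ffun 'I_m -> X} | gram (fun i => val (b i)) == G)
    \sum_(c : X) \sum_(c' : X)
  (if [&& ip_col b c == u, ip_col b c' == v & ip c c' == t]
   then Qgegenbauer d k G (map_mx val u) (map_mx val v) (val t)
          *: (basis_vec u *m (basis_vec v)^T)
   else 0)).
  apply: eq_bigr => u _; apply: eq_bigr => v _; apply: eq_bigr => t _.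
  rewrite (Ncount_sum sX) mulr_natl -scalerMnl.
  rewrite -sumrMnr; apply: eq_bigr => b _.
  rewrite -sumrMnr; apply: eq_bigr => c _.
  rewrite -sumrMnr; apply: eq_bigr => c' _.
  rewrite -!val_ip_col -val_ip !(inj_eq map_val_inj) (inj_eq val_inj).
  by case: ifP.
rewrite exchange_big_triple; apply: eq_bigr => b /eqP Gb.
rewrite exchange_big_triple; apply: eq_bigr => c _.
rewrite exchange_big_triple; apply: eq_bigr => c' _.
rewrite (bigD1 (ip_col b c)) //= (bigD1 (ip_col b c')) //= (bigD1 (ip c c')) //=.
rewrite !eqxx /= !val_ip_col Gb.
rewrite big1 => [|t /negbTE tn]; last by rewrite eq_sym tn.
rewrite big1 => [|v /negbTE vn]; last first.
  by rewrite big1 // => t _; rewrite [_ == v]eq_sym vn.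
rewrite big1 => [|u /negbTE un]; last first.
  by rewrite big1 // => v _; rewrite big1 // => t _; rewrite [_ == u]eq_sym un.
by rewrite !addr0.
Qed.

Lemma possemidef_Qmatrix (G : 'M[R]_m) (k : nat) :
  (m + 2 <= d)%N -> posdef G -> possemidef (Qmatrix k G X).
Proof.
move=> md posG; rewrite Qmatrix_sum; apply: possemidef_sum => b /eqP Gb.
apply: (possemidef_gegenbauer k (fun c => basis_vec (ip_col b c)) md).
  by rewrite Gb.
by move=> c; apply: sX (fsvalP c).
Qed.

End Qmatrix.

(** * The total number of tuples *)

Section TotalCount.

Variables (R : realType) (d m : nat) (X : {fset 'cV[R]_d}).
Hypothesis sX : on_sphere X.

(** Off the diagonal, every entry of the bordered matrix is in A, and so differs
    from the inner product 1 of two equal points. *)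
Lemma gram_bordered_injective (w : {ffun 'I_(m + 2) -> X})
    (G : 'M[R]_m) (u v : 'cV[inner_products X]_m) (t : inner_products X) :
  proper_gram (inner_products X) G ->
  gram (fun i => val (w i)) = bordered G (map_mx val u) (map_mx val v) (val t) ->
  injective w.
Proof.
case=> _ _ Goff /eqP; rewrite (gram_eq_bordered sX) /=.
case/and4P => /eqP/matrixP eG /eqP/colP eu /eqP/colP ev /eqP et.
have neq1 (c c' : X) : dotv (val c) (val c') \in inner_products X -> c <> c'.
  move=> cA cc'; case/negP: (inner_products_neq1 sX).
  by move: cA; rewrite cc' (sX (fsvalP c')).
have head_next i : w (lshift 2 i) <> w (next_to_last m).
  by apply: neq1; have := eu i; rewrite !mxE => ->; apply: fsvalP.
have head_last i : w (lshift 2 i) <> w (last_index m).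
  by apply: neq1; have := ev i; rewrite !mxE => ->; apply: fsvalP.
have next_last : w (next_to_last m) <> w (last_index m).
  by apply: neq1; rewrite et; apply: fsvalP.
have head_head i j : w (lshift 2 i) = w (lshift 2 j) -> i = j.
  move=> wij; apply/eqP; apply/negP => /negP /Goff.
  by rewrite -eG mxE => /neq1.
have tailP (j : 'I_2) : rshift m j = next_to_last m \/ rshift m j = last_index m.
  by case: (@split_ordP 1 1 j) => k ->; rewrite ord1; [left | right].
move=> i j; case: (split_ordP i) => k ->; case: (split_ordP j) => l ->.
- by move=> /head_head ->.
- by case: (tailP l) => -> wij; [case: (head_next _ wij)|case: (head_last _ wij)].
- by case: (tailP k) => -> /esym wij;
    [case: (head_next _ wij)|case: (head_last _ wij)].
by case: (tailP k) => ->; case: (tailP l) => -> // wij; case: next_last.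
Qed.

(** The only admissible (G, u, v, t) is the one read off from w. *)
Lemma card_bordered_injective (w : {ffun 'I_(m + 2) -> X}) :
  injective w -> free [seq val (w (lshift 2 i)) | i : 'I_m] ->
  (\sum_(G : 'M[inner_products1 X]_m
           | `[< proper_gram (inner_products X) (map_mx val G) >])
      \sum_(u : 'cV[inner_products X]_m) \sum_(v : 'cV[inner_products X]_m)
        \sum_(t : inner_products X)
     (gram (fun i => val (w i)) ==
       bordered (map_mx val G) (map_mx val u) (map_mx val v) (val t)))%N = 1%N.
Proof.
move=> wI fw.
have A_in i j : i != j -> dotv (val (w i)) (val (w j)) \in inner_products X.
  by move=> ij; apply: dotv_in; rewrite (inj_eq wI).
have nl i : lshift 2 i != next_to_last m.
  by rewrite /next_to_last (@eq_lrshift m 2).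
have ll i : lshift 2 i != last_index m by rewrite /last_index (@eq_lrshift m 2).
have tl : next_to_last m != last_index m.
  by rewrite (@eq_rshift m 2) (@eq_lrshift 1 1).
pose G0 : 'M[inner_products1 X]_m :=
  \matrix_(i, j) [` dotv_in1 sX (w (lshift 2 i)) (w (lshift 2 j))]%fset.
pose u0 : 'cV[inner_products X]_m := \col_i [` A_in _ _ (nl i)]%fset.
pose v0 : 'cV[inner_products X]_m := \col_i [` A_in _ _ (ll i)]%fset.
pose t0 : inner_products X := [` A_in _ _ tl]%fset.
have map_inj (S : {fset R}) p q :
  injective (map_mx val : 'M[S]_(p, q) -> 'M[R]_(p, q)).
  move=> M N /matrixP MN; apply/matrixP => i j; apply: val_inj.
  by have := MN i j; rewrite !mxE.
have eG0 : gram (fun i => val (w (lshift 2 i))) = map_mx val G0.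
  by apply/matrixP => i j; rewrite !mxE.
have wE (G : 'M[inner_products1 X]_m) (u v : 'cV[inner_products X]_m)
    (t : inner_products X) :
  (gram (fun i => val (w i)) ==
       bordered (map_mx val G) (map_mx val u) (map_mx val v) (val t))
  = [&& G0 == G, u0 == u, v0 == v & t0 == t].
  rewrite (gram_eq_bordered sX) /= eG0 (inj_eq (@map_inj _ _ _)).
  rewrite (_ : inner_col _ _ = map_mx val u0); last by apply/colP => i; rewrite !mxE.
  rewrite (_ : inner_col _ _ = map_mx val v0); last by apply/colP => i; rewrite !mxE.
  by rewrite !(inj_eq (@map_inj _ _ _)) -[dotv _ _]/(val t0) (inj_eq val_inj).
have G0proper : proper_gram (inner_products X) (map_mx val G0).
  rewrite -eG0; split; first exact: gram_free_posdef.
    by move=> i; rewrite mxE (sX (fsvalP _)).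
  by move=> i j ij; rewrite mxE A_in // eq_lshift.
under eq_bigr do under eq_bigr do under eq_bigr do under eq_bigr do rewrite wE.
rewrite (bigD1 G0) /=; last exact/asboolP.
rewrite (bigD1 u0) //= (bigD1 v0) //= (bigD1 t0) //= !eqxx /=.
rewrite big1 => [|t /negbTE tn]; last by rewrite eq_sym tn.
rewrite big1 => [|v /negbTE vn]; last first.
  by rewrite big1 // => t _; rewrite [_ == v]eq_sym vn.
rewrite big1 => [|u /negbTE un]; last first.
  by rewrite big1 // => v _; rewrite big1 // => t _; rewrite [_ == u]eq_sym un.
rewrite big1 ?addn0 // => G /andP[_ /negbTE Gn].
rewrite big1 // => u _; rewrite big1 // => v _; rewrite big1 // => t _.
by rewrite [_ == G]eq_sym Gn.
Qed.

Lemma sum_Ncount : independent_heads m X ->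
  (\sum_(G : 'M[inner_products1 X]_m
           | `[< proper_gram (inner_products X) (map_mx val G) >])
      \sum_(u : 'cV[inner_products X]_m) \sum_(v : 'cV[inner_products X]_m)
        \sum_(t : inner_products X)
          Ncount X (map_mx val G) (map_mx val u) (map_mx val v) (val t))%N
   = #|` X | ^_ (m + 2).
Proof.
move=> indep.
under eq_bigr => G _.
  under eq_bigr => u _.
    under eq_bigr => v _.
      under eq_bigr => t _ do rewrite /Ncount -sum1dep_card big_mkcond /=.
      rewrite exchange_big /=.
      over.
    rewrite exchange_big /=.
    over.
  rewrite exchange_big /=.
  over.
rewrite exchange_big /= cardfE -[(m + 2)%N in RHS]card_ord -card_inj_ffuns.
rewrite -sum1dep_card [RHS]big_mkcond /=; apply: eq_bigr => w _.
case: injectiveP => [wI|nwI].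
  rewrite -[RHS](card_bordered_injective wI (indep w wI)).
  apply: eq_bigr => G _; apply: eq_bigr => u _; apply: eq_bigr => v _.
  by apply: eq_bigr => t _; case: (_ == _).
rewrite big1 // => G /asboolP GP; rewrite big1 // => u _; rewrite big1 // => v _.
rewrite big1 // => t _; case: eqP => // /(gram_bordered_injective GP).
by [].
Qed.

End TotalCount.

Theorem theorem2p13 (R : realType) (d m s : nat) (X : {fset 'cV[R]_d})
  (hm : (1 <= m <= d - 2)%N) (hX : spherical_distance_set s X) :
  (independent_heads m X ->
   (\sum_(G : 'M[inner_products1 X]_m
           | `[< proper_gram (inner_products X) (map_mx val G) >])
      \sum_(u : 'cV[inner_products X]_m) \sum_(v : 'cV[inner_products X]_m)
        \sum_(t : inner_products X)
          Ncount X (map_mx val G) (map_mx val u) (map_mx val v) (val t))%N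
   = #|` X | ^_ (m + 2)) /\
  (forall G : 'M[R]_m, proper_gram (inner_products X) G ->
   forall k : nat, possemidef (Qmatrix k G X)).
Proof.
have [sX _] := hX; split; first exact: sum_Ncount.
move=> G [posG _ _] k; apply: possemidef_Qmatrix => //.
by case/andP: hm; lia.
Qed.
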